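(* Let $S$ and $T$ be the complex vector spaces of homogeneous polynomials in $\mathbb{C}[z,w]$ of degree $8$ and $12$ respectively. For general $(f,g)\in S\times T$, the decomposition of the degree $24$ polynomial $h=f^3+g^2$ into the sum of a cube and a square is unique up to multiplication by a cubic and a square root of unity. That is, there exists a non-empty Zariski open subset $W\subset S\times T$ such that for every $(f,g)\in W$ and every $(\varphi,\psi)\in S\times T$ satisfying $$\varphi^3+\psi^2=f^3+g^2,$$ there exist $\zeta\in\mathbb{C}$ with $\zeta^3=1$ and $\epsilon\in\{1,-1\}$ such that $\varphi=\zeta f$ and $\psi=\epsilon g$.
   Context: ''General'' means: for all points of some non-empty Zariski open subset of the affine space $S\times T$. *)

(* Defs.v *)
From mathcomp Require Export all_boot all_algebra.
From mathcomp Require Export classical_sets reals.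
From mathcomp Require Export complex.
From mathcomp Require Export mpoly.

Set Implicit Arguments.
Unset Strict Implicit.
Unset Printing Implicit Defensive.

Import GRing.Theory.
Local Open Scope ring_scope.
Local Open Scope classical_set_scope.

Section Zariski.
Variables (K : fieldType) (V : vectType K).

(* V is viewed as affine space through a basis; since a linear change of
   coordinates maps polynomials to polynomials, the closed sets do not depend
   on the basis. *)
Definition affine_coord (v : V) : 'I_(\dim {:V}) -> K :=
  fun i => coord (vbasis {:V}) i v.

Definition zero_locus (I : set {mpoly K[\dim {:V}]}) : set V :=
  [set v | forall p, I p -> p.@[affine_coord v] = 0].

Definition zariski_closed (Z : set V) : Prop := exists I, Z = zero_locus I.

Definition zariski_open (W : set V) : Prop := zariski_closed (~` W).

End Zariski.

(* Homogeneous polynomials of degree d in C[z, w] (with 0 included), where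
   C = R[i]. *)
Definition binary_form (R : realType) (d : nat) : vectType R[i] :=
  dhomog 2 R[i] d.

(* Main.v *)
(* If phi^3 + psi^2 = f^3 + g^2 then phi^3 - f^3 = v w with v = g - psi and
   w = g + psi.  If v w = 0 then psi is g or -g and phi is a cube root of unity
   times f.  Otherwise, dehomogenizing, v and w are constant multiples of
   products of linear factors of phi^3 - f^3, so the coefficients of g = (v + w)/2
   are integral over the algebra generated by the 18 coefficients of f and phi,
   the leading coefficients of v and w, and the inverse of their product.  Thus
   the 22 coefficients of the bad pairs (f, g) are integral over 21 parameters,
   so a nonzero polynomial vanishes on all bad pairs with v and w of given
   degrees, and W is the locus where the product of these finitely many
   polynomials does not vanish.

   The algebraic dependence is uniform over the points because it is obtained by
   counting: a monomial of degree at most D in each of the n coordinates is a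
   combination of monomials in the m < n parameters, of degree O(D) in each, times
   boundedly many monomials in the roots, and (D + 1)^n outgrows O(D)^m. *)

From HB Require Import structures.
From mathcomp Require Import ring.
Require Import Defs.

Set Implicit Arguments.
Unset Strict Implicit.
Unset Printing Implicit Defensive.

Import GRing.Theory.
Local Open Scope ring_scope.

(** * Counting algebraic dependence *)

(** The matrix of [c] has rank at most [#|J|], so its left kernel is nonzero. *)
Lemma nontrivial_relation (K : fieldType) (I J : finType) (c : I -> J -> K) :
  (#|J| < #|I|)%N ->
  exists2 l : I -> K, exists i, l i != 0 & forall j, \sum_i l i * c i j = 0.
Proof.
move=> lt_JI; pose A := \matrix_(i < #|I|, j < #|J|) c (enum_val i) (enum_val j).
have /rowV0Pn [v /sub_kermxP vA v_neq0] : kermx A != 0.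
  by rewrite -mxrank_eq0 mxrank_ker -lt0n subn_gt0 (leq_ltn_trans (rank_leq_col A)).
exists (fun i => v 0 (enum_rank i)) => [|j].
  have [i vi] : exists i, v 0 i != 0.
    apply/existsP; apply: contraNT v_neq0; rewrite negb_exists => /forallP v0.
    by apply/eqP/rowP => i; rewrite mxE; apply/eqP; rewrite -[_ == _]negbK v0.
  by exists (enum_val i); rewrite enum_valK.
transitivity ((v *m A) 0 (enum_rank j)); last by rewrite vA mxE.
rewrite mxE (reindex (@enum_val I (mem I))) /=; last first.
  by exists enum_rank => x _; rewrite ?enum_valK ?enum_rankK.
by apply: eq_bigr => i _; rewrite mxE enum_valK enum_rankK.
Qed.

(** * Functions integral over finitely many parameters *)

Section IntegralFunctions.
Variables (K : fieldType) (T : Type) (m N M : nat).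
Variables (y : 'I_m -> T -> K) (r : 'I_N -> T -> K).

Definition mono (b : 'I_m -> nat) (e : 'I_N -> nat) (z : T) : K :=
  \prod_i y i z ^+ b i * \prod_j r j z ^+ e j.

(** The bound [d] on the exponents of the parameters [y] will grow, while the bound [M] on those of
    the roots [r] stays fixed. Equalities are pointwise, so the span is stable under [=1]. *)
Inductive in_span (d : nat) : (T -> K) -> Prop :=
| in_span_mono b e F : (forall i, b i <= d)%N -> (forall j, e j <= M)%N ->
    (forall z, F z = mono b e z) -> in_span d F
| in_span0 F : (forall z, F z = 0) -> in_span d F
| in_span_lin c F G H : in_span d F -> in_span d G ->
    (forall z, H z = c * F z + G z) -> in_span d H.

(** Multiplication by [F] costs a bounded number of degrees in the parameters, uniformly in [d].
    This replaces membership in a finite algebra over the parameters and is stable under sums and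
    products. *)
Definition tame (F : T -> K) : Prop :=
  exists k, forall d G, in_span d G -> in_span (d + k) (fun z => F z * G z).

Lemma in_span_ext d F G : F =1 G -> in_span d F -> in_span d G.
Proof.
move=> eFG sF; apply: (@in_span_lin d 1 F (fun=> 0)) => // [|z].
  exact: in_span0.
by rewrite mul1r addr0 eFG.
Qed.

Lemma in_span_leq d d' F : (d <= d')%N -> in_span d F -> in_span d' F.
Proof.
move=> le_dd'; elim=> {F} [b e F hb he eF|F eF|c F G H _ sF _ sG eH].
- by apply: in_span_mono he eF => i; apply: leq_trans (hb i) _.
- exact: in_span0 eF.
- exact: in_span_lin sF sG eH.
Qed.

Lemma in_spanD d F G : in_span d F -> in_span d G ->
  in_span d (fun z => F z + G z).
Proof. by move=> sF sG; apply: (@in_span_lin _ 1 _ _ _ sF sG) => z; rewrite mul1r. Qed.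

Lemma in_span_sum d (I : Type) (s : seq I) (F : I -> T -> K) :
  (forall i, in_span d (F i)) -> in_span d (fun z => \sum_(i <- s) F i z).
Proof.
move=> sF; elim: s => [|i s IHs]; first by apply: in_span0 => z; rewrite big_nil.
by apply: (in_span_ext _ (in_spanD (sF i) IHs)) => z; rewrite big_cons.
Qed.

Lemma mul_in_span (F : T -> K) d k :
  (forall b e, (forall i, b i <= d)%N -> (forall j, e j <= M)%N ->
     in_span (d + k) (fun z => F z * mono b e z)) ->
  forall G, in_span d G -> in_span (d + k) (fun z => F z * G z).
Proof.
move=> sF G; elim=> {G} [b e G hb he eG|G eG|c G1 G2 G _ sG1 _ sG2 eG].
- by apply: (in_span_ext _ (sF b e hb he)) => z; rewrite eG.
- by apply: in_span0 => z; rewrite eG mulr0.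
- by apply: (@in_span_lin _ c _ _ _ sG1 sG2) => z; rewrite eG mulrDr mulrCA.
Qed.

Lemma tame_ext F G : F =1 G -> tame F -> tame G.
Proof.
move=> eFG [k tF]; exists k => d H sH.
by apply: (in_span_ext _ (tF d H sH)) => z; rewrite eFG.
Qed.

Lemma tame_cst c : tame (fun=> c).
Proof.
exists 0%N => d G sG; rewrite addn0.
by apply: (@in_span_lin d c G (fun=> 0)) => // [|z]; [exact: in_span0|rewrite addr0].
Qed.

Lemma tameD F G : tame F -> tame G -> tame (fun z => F z + G z).
Proof.
move=> [k tF] [l tG]; exists (k + l)%N => d H sH.
have sFH : in_span (d + (k + l)) (fun z => F z * H z).
  by apply: in_span_leq (tF d H sH); rewrite leq_add2l leq_addr.
have sGH : in_span (d + (k + l)) (fun z => G z * H z).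
  by apply: in_span_leq (tG d H sH); rewrite leq_add2l leq_addl.
by apply: (in_span_ext _ (in_spanD sFH sGH)) => z; rewrite mulrDl.
Qed.

Lemma tameM F G : tame F -> tame G -> tame (fun z => F z * G z).
Proof.
move=> [k tF] [l tG]; exists (l + k)%N => d H sH; rewrite addnA.
by apply: (in_span_ext _ (tF _ _ (tG d H sH))) => z; rewrite mulrA.
Qed.

Lemma tame_sum (I : Type) (s : seq I) (F : I -> T -> K) :
  (forall i, tame (F i)) -> tame (fun z => \sum_(i <- s) F i z).
Proof.
move=> tF; elim: s => [|i s IHs].
  by apply: (tame_ext _ (tame_cst 0)) => z; rewrite big_nil.
by apply: (tame_ext _ (tameD (tF i) IHs)) => z; rewrite big_cons.
Qed.

Lemma tame_param i : tame (y i).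
Proof.
exists 1%N => d; apply: mul_in_span => b e hb he.
apply: (@in_span_mono _ (fun l => (i == l) + b l)%N e) => // [l|z].
  by rewrite addnC leq_add ?hb ?leq_b1.
rewrite /mono mulrA; congr (_ * _).
rewrite (bigD1 i) //= [in RHS](bigD1 i) //= eqxx exprS mulrA; congr (_ * _).
by apply: eq_bigr => l; rewrite eq_sym => /negPf->.
Qed.

(** Multiplication by [r j] either keeps its exponent within [M] or produces [r j ^+ M.+1], which
    the integral equation rewrites in lower powers. *)
Lemma tame_root j (h : 'I_M.+1 -> T -> K) : (forall k, tame (h k)) ->
  (forall z, r j z ^+ M.+1 = \sum_k h k z * r j z ^+ k) -> tame (r j).
Proof.
move=> th rjM.
(* [e' e k] is [e] with the exponent of [r j] replaced by [k]. *)
pose e' (e : 'I_N -> nat) k l := if l == j then k else e l.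
have monoE b e k z : mono b (e' e k) z =
    r j z ^+ k * (\prod_i y i z ^+ b i * \prod_(l | l != j) r l z ^+ e l).
  rewrite /mono mulrCA; congr (_ * _); rewrite (bigD1 j) //= /e' eqxx; congr (_ * _).
  by apply: eq_bigr => l /negPf->.
have e'E e b z : mono b e z = mono b (e' e (e j)) z.
  congr (_ * _); apply: eq_bigr => l _.
  by rewrite /e'; case: eqP => [->|].
have [k hk] := fin_all_exists th.
exists (\max_l k l).+1 => d; apply: mul_in_span => b e hb he.
have [ltM|geM] := ltnP (e j) M.
  apply: (@in_span_mono _ b (e' e (e j).+1)) => [i|l|z].
  - by apply: leq_trans (hb i) _; rewrite leq_addr.
  - by rewrite /e'; case: eqP.
  - by rewrite e'E !monoE exprS mulrA.
have ejM : e j = M by apply/eqP; rewrite eqn_leq he.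
(* Overflow case: the equation is substituted, and tameness of each coefficient [h l] absorbs it. *)
apply: (@in_span_ext _ (fun z => \sum_(l < M.+1) h l z * mono b (e' e l) z)).
  move=> z; rewrite (e'E e) monoE ejM mulrA -exprS rjM mulr_suml.
  by apply: eq_bigr => l _; rewrite monoE mulrA.
apply: in_span_sum => l.
have le_k : (d + k l <= d + (\max_l k l).+1)%N.
  by rewrite leq_add2l leqW // leq_bigmax.
apply: in_span_leq le_k _; apply: hk; apply: (@in_span_mono _ b (e' e l)) => // i.
by rewrite /e'; case: ifP => // _; rewrite -ltnS.
Qed.

(** The coefficients do not depend on the point [z], so linear algebra on them yields relations
    valid at every point. *)
Lemma in_spanE d F : in_span d F ->
  exists c : {ffun 'I_m -> 'I_d.+1} * {ffun 'I_N -> 'I_M.+1} -> K,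
    forall z, F z = \sum_u c u * mono (fun i => u.1 i) (fun j => u.2 j) z.
Proof.
elim=> {F} [b e F hb he eF|F eF|c F G H _ [cF eF] _ [cG eG] eH].
- pose u0 := ([ffun i => inord (b i)] : {ffun 'I_m -> 'I_d.+1},
              [ffun j => inord (e j)] : {ffun 'I_N -> 'I_M.+1}).
  exists (fun u => (u == u0)%:R) => z.
  rewrite (bigD1 u0) //= eqxx mul1r big1 ?addr0 => [|u /negPf->]; last by rewrite mul0r.
  by rewrite eF /mono; congr (_ * _); apply: eq_bigr => i _; rewrite ffunE inordK ?ltnS.
- by exists (fun=> 0) => z; rewrite eF big1 // => u _; rewrite mul0r.
- exists (fun u => c * cF u + cG u) => z; rewrite eH eF eG mulr_sumr -big_split.
  by apply: eq_bigr => u _; rewrite mulrDl mulrA.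
Qed.

Lemma tame_algebraically_dependent n (x : 'I_n -> T -> K) :
  (m < n)%N -> (forall i, tame (x i)) ->
  exists2 P : {mpoly K[n]}, P != 0 & forall z, P.@[fun i => x i z] = 0.
Proof.
move=> lt_mn tx; have [k0 hk0] := fin_all_exists tx.
pose k := \max_i k0 i.
have hk i d G : in_span d G -> in_span (d + k) (fun z => x i z * G z).
  by move=> sG; apply: in_span_leq (hk0 i d G sG); rewrite leq_add2l leq_bigmax.
have hkX i a d G : in_span d G -> in_span (d + a * k) (fun z => x i z ^+ a * G z).
  elim: a d G => [|a IHa] d G sG.
    by rewrite addn0; apply: (in_span_ext _ sG) => z; rewrite mul1r.
  rewrite mulSn addnA; apply: (in_span_ext _ (IHa _ _ (hk i _ _ sG))) => z.
  by rewrite exprSr mulrA.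
(* Each of the [n] coordinates is used at most [D] times, at a cost of [k] degrees each time,
   starting from the monomial 1. *)
have sprod D (a : 'I_n -> nat) : (forall i, a i <= D)%N ->
    in_span (n * k * D) (fun z => \prod_i x i z ^+ a i).
  move=> aD; apply: (@in_span_leq (\sum_i a i * k)%N).
    rewrite -mulnA -[X in (_ <= X * _)%N]card_ord -sum_nat_const.
    by apply: leq_sum => i _; rewrite mulnC leq_mul2l aD orbT.
  elim: (index_enum _) => [|i s IHs].
    apply: (@in_span_mono _ (fun=> 0%N) (fun=> 0%N)) => // z.
    by rewrite big_nil /mono !big1 ?mulr1.
  rewrite big_cons addnC; apply: (in_span_ext _ (hkX i (a i) _ _ IHs)) => z.
  by rewrite big_cons.
(* With this [D], since [n k D + 1 <= (n k + 1)(D + 1)], the monomials of the span number at most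
   [D (D + 1)^m], which is less than [(D + 1)^(m + 1) <= (D + 1)^n]. *)
pose D := ((n * k).+1 ^ m * M.+1 ^ N)%N.
have hD : ((n * k * D).+1 ^ m * M.+1 ^ N < D.+1 ^ n)%N.
  have le1 : ((n * k * D).+1 <= (n * k).+1 * D.+1)%N.
    by rewrite mulnS mulSn !addSn ltnS addnA leq_addl.
  apply: (@leq_trans (D.+1 ^ m.+1)); last exact: leq_pexp2l.
  apply: (@leq_ltn_trans (D * D.+1 ^ m)).
    have leX : ((n * k * D).+1 ^ m <= (n * k).+1 ^ m * D.+1 ^ m)%N.
      by rewrite -expnMn; case: (posnP m) => [->|m_gt0] //; rewrite leq_exp2r.
    by apply: leq_trans (leq_mul leX (leqnn _)) _; rewrite mulnAC.
  by rewrite expnS ltn_mul2r expn_gt0 /=.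
have /fin_all_exists[c hc] (a : {ffun 'I_n -> 'I_D.+1}) := in_spanE
  (sprod D (fun i => a i) (fun i => leq_ord (a i))).
have [|l [a0 la0] hl] := nontrivial_relation c.
  by rewrite card_prod !card_ffun !card_ord.
pose X (a : {ffun 'I_n -> 'I_D.+1}) := [multinom a i : nat | i < n].
exists (\sum_a l a *: 'X_[X a]) => [|z].
  apply: contraNneq la0 => /(congr1 (mcoeff (X a0))).
  rewrite mcoeff0 raddf_sum (bigD1 a0) //= mcoeffZ mcoeffX eqxx mulr1.
  rewrite big1 ?addr0 => [->//|a ne_a]; rewrite mcoeffZ mcoeffX.
  case: eqP => [eX|_]; last by rewrite mulr0.
  case/eqP: ne_a; apply/ffunP => i; apply/val_inj.
  by have := congr1 (fun m : 'X_{1..n} => m i) eX; rewrite !mnmE.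
rewrite raddf_sum /=.
under eq_bigr => a _.
  rewrite mevalZ mevalX; under eq_bigr do rewrite mnmE.
  rewrite hc mulr_sumr.
  over.
rewrite exchange_big big1 // => u _.
by under eq_bigr do rewrite mulrA; rewrite -mulr_suml hl mul0r.
Qed.

(** * Univariate polynomials with tame coefficients *)

Definition tamep (Q : T -> {poly K}) : Prop := forall i, tame (fun z => (Q z)`_i).

Lemma tamep_ext P Q : P =1 Q -> tamep P -> tamep Q.
Proof. by move=> eP tP i; apply: (tame_ext _ (tP i)) => z; rewrite eP. Qed.

Lemma tamep_cst p : tamep (fun=> p).
Proof. by move=> i; apply: tame_cst. Qed.

Lemma tamepC F : tame F -> tamep (fun z => (F z)%:P).
Proof.
move=> tF [|i]; first by apply: (tame_ext _ tF) => z; rewrite coefC.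
by apply: (tame_ext _ (tame_cst 0)) => z; rewrite coefC.
Qed.

Lemma tamepD P Q : tamep P -> tamep Q -> tamep (fun z => P z + Q z).
Proof.
by move=> tP tQ i; apply: (tame_ext _ (tameD (tP i) (tQ i))) => z; rewrite coefD.
Qed.

Lemma tamepM P Q : tamep P -> tamep Q -> tamep (fun z => P z * Q z).
Proof.
move=> tP tQ i; apply: (tame_ext (F := fun z => \sum_(j < i.+1) (P z)`_j * (Q z)`_(i - j))).
  by move=> z; rewrite coefM.
by apply: tame_sum => j; apply: tameM.
Qed.

Lemma tamepN P : tamep P -> tamep (fun z => - P z).
Proof.
move=> tP; apply: (tamep_ext _ (tamepM (tamep_cst (-1)) tP)) => z.
by rewrite mulN1r.
Qed.

Lemma tamepX P n : tamep P -> tamep (fun z => P z ^+ n).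
Proof.
move=> tP; elim: n => [|n IHn]; first exact: tamep_cst.
by apply: (tamep_ext _ (tamepM tP IHn)) => z; rewrite exprS.
Qed.

Lemma tamep_prod (I : Type) (s : seq I) (P : I -> T -> {poly K}) :
  (forall i, tamep (P i)) -> tamep (fun z => \prod_(i <- s) P i z).
Proof.
move=> tP; elim: s => [|i s IHs].
  by apply: (tamep_ext _ (tamep_cst 1)) => z; rewrite big_nil.
by apply: (tamep_ext _ (tamepM (tP i) IHs)) => z; rewrite big_cons.
Qed.

Lemma tame_monic_root (Q : T -> {poly K}) j : tamep Q ->
  (forall z, Q z \is monic) -> (forall z, size (Q z) = M.+2) ->
  (forall z, root (Q z) (r j z)) -> tame (r j).
Proof.
move=> tQ Qmonic sQ Qr; apply: (@tame_root _ (fun k z => - (Q z)`_k)) => [k|z].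
  by apply: (tame_ext _ (tameM (tame_cst (-1)) (tQ k))) => z; rewrite mulN1r.
have /eqP := Qr z; rewrite horner_coef sQ big_ord_recr /=.
have /eqP := Qmonic z; rewrite lead_coefE sQ /= => ->; rewrite mul1r.
move=> /eqP; rewrite addrC addr_eq0 => /eqP ->; rewrite -sumrN.
by apply: eq_bigr => k _; rewrite mulNr.
Qed.
End IntegralFunctions.

(* [v] and [w] are products of linear factors whose roots are integral over
   the algebra generated by the [2d + 2] coefficients of [f] and [phi], the
   leading coefficients of [v] and [w] and the inverse of their product. *)
Lemma factor_algebraically_dependent (K : closedFieldType) (T : Type) (d a b e n : nat)
    (f phi v w : T -> {poly K}) (x : 'I_n -> T -> K)
    (c : 'I_n -> 'I_d.+1 -> K) (c' : 'I_n -> 'I_e -> K) :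
  (d.+1 + d.+1 + 3 < n)%N ->
  (forall z, size (f z) <= d.+1)%N -> (forall z, size (phi z) <= d.+1)%N ->
  (forall z, size (v z) = a.+1) -> (forall z, size (w z) = b.+1) ->
  (forall z, v z * w z = phi z ^+ 3 - f z ^+ 3) ->
  (forall i z, x i z = \sum_k c i k * (f z)`_k + \sum_k c' i k * (v z + w z)`_k) ->
  exists2 P : {mpoly K[n]}, P != 0 & forall z, P.@[fun i => x i z] = 0.
Proof.
move=> lt_n sf sphi sv sw vwE xE.
pose rts (p : {poly K}) := sval (closed_field_poly_normal p).
have rtsE p : p = lead_coef p *: \prod_(t <- rts p) ('X - t%:P).
  exact: svalP (closed_field_poly_normal p).
have size_rts (p : {poly K}) k : size p = k.+1 -> size (rts p) = k.
  move=> sp; have p_neq0 : p != 0 by rewrite -size_poly_gt0 sp.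
  have := congr1 (fun q : {poly K} => size q) (rtsE p).
  by rewrite size_scale ?lead_coef_eq0 // size_prod_XsubC sp => -[].
pose al z := lead_coef (v z); pose be z := lead_coef (w z).
have al0 z : al z != 0 by rewrite lead_coef_eq0 -size_poly_gt0 sv.
have be0 z : be z != 0 by rewrite lead_coef_eq0 -size_poly_gt0 sw.
(* The parameters in order: coefficients of [f], coefficients of [phi], then the two leading
   coefficients and the inverse of their product. *)
pose y (i : 'I_(d.+1 + d.+1 + 3)) z := nth 0
  (mkseq (nth 0 (f z)) d.+1 ++ mkseq (nth 0 (phi z)) d.+1 ++
   [:: al z; be z; (al z * be z)^-1]) i.
pose r (j : 'I_(a + b)) z := nth 0 (rts (v z) ++ rts (w z)) j.
pose M := (a + b)%N.
have ty k : (k < d.+1 + d.+1 + 3)%N -> tame M y r (fun z => nth 0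
  (mkseq (nth 0 (f z)) d.+1 ++ mkseq (nth 0 (phi z)) d.+1 ++
   [:: al z; be z; (al z * be z)^-1]) k).
  by move=> lt_k; apply: (tame_ext _ (tame_param M y r (Ordinal lt_k))).
have tf : tamep M y r f.
  move=> k; have [lt_k|le_k] := ltnP k d.+1.
    have lt_k' : (k < d.+1 + d.+1 + 3)%N by rewrite -addnA ltn_addr.
    apply: (tame_ext _ (ty k lt_k')) => z.
    by rewrite nth_cat size_mkseq lt_k nth_mkseq.
  apply: (tame_ext _ (tame_cst M y r 0)) => z; rewrite nth_default //.
  exact: leq_trans (sf z) le_k.
have tphi : tamep M y r phi.
  move=> k; have [lt_k|le_k] := ltnP k d.+1.
    have lt_k' : (d.+1 + k < d.+1 + d.+1 + 3)%N by rewrite -addnA ltn_add2l ltn_addr.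
    apply: (tame_ext _ (ty _ lt_k')) => z.
    rewrite nth_cat size_mkseq ltnNge leq_addr [~~ _]/= addKn.
    by rewrite nth_cat size_mkseq lt_k nth_mkseq.
  apply: (tame_ext _ (tame_cst M y r 0)) => z; rewrite nth_default //.
  exact: leq_trans (sphi z) le_k.
have tlast k : (k < 3)%N -> tame M y r (fun z =>
    nth 0 [:: al z; be z; (al z * be z)^-1] k).
  move=> lt_k; have lt_k' : (d.+1 + (d.+1 + k) < d.+1 + d.+1 + 3)%N.
    by rewrite addnA ltn_add2l.
  apply: (tame_ext _ (ty _ lt_k')) => z.
  by rewrite !nth_cat !size_mkseq ltnNge leq_addr [~~ _]/= addKn ltnNge leq_addr [~~ _]/= addKn.
(* The inverse of [al z * be z] makes the product of [v] and [w] monic; the factor ['X] raises its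
   degree from [M] to [M.+1], the degree expected by [tame_monic_root], even when [a + b = 0]. *)
pose Q z := ((al z * be z)^-1)%:P * (phi z ^+ 3 - f z ^+ 3) * 'X.
have QE z : Q z = \prod_(t <- rts (v z) ++ rts (w z)) ('X - t%:P) * 'X.
  have -> : Q z = ((al z * be z)^-1)%:P * (v z * w z) * 'X by rewrite vwE.
  rewrite {1}(rtsE (v z)) {1}(rtsE (w z)) -/(al z) -/(be z) -!mul_polyC mulrACA.
  by rewrite -polyCM [_%:P * (_%:P * _)]mulrA -polyCM mulVf ?mulf_neq0 // mul1r big_cat.
have size_r z : size (rts (v z) ++ rts (w z)) = (a + b)%N.
  by rewrite size_cat (size_rts _ _ (sv z)) (size_rts _ _ (sw z)).
have tr j : tame M y r (r j).
  apply: (tame_monic_root (Q := Q)) => [|z|z|z].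
  - apply: tamepM; last exact: tamep_cst.
    apply: tamepM; first by apply: tamepC; apply: (tlast 2).
    by apply: tamepD; [apply: tamepX|apply/tamepN/tamepX].
  - by rewrite QE monicMr ?monicX // monic_prod_XsubC.
  - rewrite QE size_mulX ?size_prod_XsubC ?size_r //.
    by rewrite monic_neq0 // monic_prod_XsubC.
  - by rewrite QE rootM root_prod_XsubC mem_nth ?size_r.
have tv : tamep M y r v.
  have tP : tamep M y r (fun z => (al z)%:P * \prod_(i < a) ('X - (r (lshift b i) z)%:P)).
    apply: tamepM; first by apply: tamepC; apply: (tlast 0).
    apply: tamep_prod => i; apply: tamepD; first exact: tamep_cst.
    by apply/tamepN/tamepC.
  apply: (tamep_ext _ tP) => z; rewrite [RHS]rtsE mul_polyC; congr (_ *: _).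
  rewrite (big_nth 0) (size_rts _ _ (sv z)) big_mkord; apply: eq_bigr => i _.
  by rewrite /r nth_cat (size_rts _ _ (sv z)) /= ltn_ord.
have tw : tamep M y r w.
  have tP : tamep M y r (fun z => (be z)%:P * \prod_(i < b) ('X - (r (rshift a i) z)%:P)).
    apply: tamepM; first by apply: tamepC; apply: (tlast 1).
    apply: tamep_prod => i; apply: tamepD; first exact: tamep_cst.
    by apply/tamepN/tamepC.
  apply: (tamep_ext _ tP) => z; rewrite [RHS]rtsE mul_polyC; congr (_ *: _).
  rewrite (big_nth 0) (size_rts _ _ (sw z)) big_mkord; apply: eq_bigr => i _.
  by rewrite /r nth_cat (size_rts _ _ (sv z)) /= ltnNge leq_addr [~~ _]/= addKn.
apply: (@tame_algebraically_dependent _ _ _ _ M y r) => // i.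
have tx := tameD (tame_sum (index_enum _) (fun k => tameM (tame_cst M y r (c i k)) (tf k)))
  (tame_sum (index_enum _) (fun k => tameM (tame_cst M y r (c' i k)) (tamepD tv tw k))).
by apply: (tame_ext _ tx) => z; rewrite xE.
Qed.

(** * Nonvanishing points of polynomials *)

(** Uniqueness of base [M] digits: the remainder modulo [M] gives the lowest digit, the quotient the
    others by induction. *)
Lemma base_expansion_inj M n (a b : 'I_n -> nat) :
  (forall i, a i < M)%N -> (forall i, b i < M)%N ->
  (\sum_i a i * M ^ i = \sum_i b i * M ^ i)%N -> a =1 b.
Proof.
elim: n a b => [|n IHn] a b aM bM; first by move=> _ [].
have split_sum c : (\sum_(i < n.+1) c i * M ^ i =
    (\sum_(i < n) c (lift ord0 i) * M ^ i) * M + c ord0)%N.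
  rewrite big_ord_recl expn0 muln1 addnC big_distrl; congr (_ + _)%N.
  by apply: eq_bigr => i _; rewrite /= expnSr mulnA.
rewrite !split_sum => eq_ab.
have M_gt0 : (0 < M)%N by apply: leq_ltn_trans (aM ord0).
have eq0 : a ord0 = b ord0.
  by have := congr1 (modn^~ M) eq_ab; rewrite !modnMDl !modn_small.
have eqS : (fun i => a (lift ord0 i)) =1 (fun i => b (lift ord0 i)).
  apply: IHn => [i|i|]; [exact: aM|exact: bM|].
  by have := congr1 (divn^~ M) eq_ab; rewrite !divnMDl // !divn_small // !addn0.
by move=> i; case: (unliftP ord0 i) => [j|] ->.
Qed.

(** The [size p] integers starting from 0 are distinct in [K], too many to be all roots. *)
Lemma exists_nonroot (K : numDomainType) (p : {poly K}) :
  p != 0 -> exists t, p.[t] != 0.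
Proof.
move=> p_neq0; pose s := [seq i%:R : K | i <- iota 0 (size p)].
have us : uniq s.
  rewrite map_inj_uniq ?iota_uniq // => i j /eqP.
  by rewrite Num.Theory.eqr_nat => /eqP.
have [/(max_poly_roots p_neq0)/(_ us)|] := boolP (all (root p) s).
  by rewrite size_map size_iota ltnn.
by rewrite -has_predC => /hasP[t _ /= nrt]; exists t.
Qed.

(* Kronecker substitution ['X_i := t ^ (M ^ i)] with [M] exceeding all exponents *)
Lemma exists_meval_neq0 (K : numDomainType) n (p : {mpoly K[n]}) :
  p != 0 -> exists x, p.@[x] != 0.
Proof.
move=> p_neq0; have [m0 m0P] : exists m, m \in msupp p.
  by exists (mlead p); exact: mlead_supp.
pose M := msize p.
pose wt (m : 'X_{1..n}) := (\sum_i m i * M ^ i)%N.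
have ltM m i : m \in msupp p -> (m i < M)%N.
  move=> /msize_mdeg_lt; apply: leq_ltn_trans.
  by rewrite mdegE (bigD1 i) //= leq_addr.
pose q := \sum_(m <- msupp p) p@_m *: 'X^(wt m) : {poly K}.
have q_neq0 : q != 0.
  (* By uniqueness of digits no other monomial of the support has the weight of [m0], so nothing
     cancels this coefficient. *)
  have: q`_(wt m0) != 0; last by apply: contraNneq => ->; rewrite coef0.
  rewrite coef_sum (bigD1_seq m0) ?msupp_uniq //= coefZ coefXn eqxx mulr1.
  rewrite big_seq_cond big1 ?addr0 -?mcoeff_msupp //.
  move=> m /andP[mP m_neq]; rewrite coefZ coefXn.
  case: eqP => [eq_wt|_]; last by rewrite mulr0.
  case/negP: m_neq; apply/eqP/mnmP; apply: (base_expansion_inj _ _ (esym eq_wt)) => i; exact: ltM.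
have [t qt] := exists_nonroot q_neq0; exists (fun i => t ^+ (M ^ i)).
rewrite mevalE; apply: contraNneq qt => <-; apply/eqP.
rewrite /q horner_sum; apply: eq_bigr => m _.
rewrite hornerZ hornerXn /wt; congr (_ * _).
rewrite expr_sum; apply: eq_bigr => i _.
by rewrite -exprM mulnC.
Qed.

(** * Binary forms *)

Section Dehomogenize.
Variable K : comNzRingType.

Definition dehomogenize : {mpoly K[2]} -> {poly K} :=
  mmap (@polyC K) (fun i : 'I_2 => if i == 0 then 'X else 1).

HB.instance Definition _ := GRing.RMorphism.on dehomogenize.

Definition mon2 (d k : nat) : 'X_{1..2} :=
  [multinom if i == 0%R then k else (d - k)%N | i < 2].

Lemma dehomogenizeZ c p : dehomogenize (c *: p) = c *: dehomogenize p.
Proof. by rewrite /dehomogenize mmapZ mul_polyC. Qed.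

Lemma dehomogenizeX m : dehomogenize 'X_[m] = 'X^(m 0).
Proof.
by rewrite /dehomogenize mmapX /mmap1 big_ord_recl big_ord1 expr1n mulr1.
Qed.

Lemma mon2_mdeg (m : 'X_{1..2}) : mon2 (mdeg m) (m 0) = m.
Proof.
apply/mnmP => i; rewrite mnmE mdegE big_ord_recl big_ord1 addKn.
by case: i => -[|[|//]] lt_i; congr (m _); apply/val_inj.
Qed.

Lemma mdeg_mon2 d k : (k <= d)%N -> mdeg (mon2 d k) = d.
Proof. by move=> le_kd; rewrite mdegE big_ord_recl big_ord1 !mnmE subnKC. Qed.

Lemma size_dehomogenize d p : p \is d.-homog -> (size (dehomogenize p) <= d.+1)%N.
Proof.
move=> /dhomogP hp'; have hp m : m \in msupp p -> mdeg m = d := @hp' m.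
rewrite (mpolyE p) raddf_sum /= big_seq.
apply: (leq_trans (size_sum _ _ _)); apply/bigmax_leqP_seq => m mp _.
rewrite dehomogenizeZ dehomogenizeX; apply: (leq_trans (size_scale_leq _ _)).
by rewrite size_polyXn ltnS -(hp m mp) mdegE (bigD1 0) //= leq_addr.
Qed.

(** In fixed degree [d] a monomial is determined by its exponent at index 0, so setting the other
    variable to 1 loses nothing. *)
Lemma homogenizeK d p : p \is d.-homog ->
  p = \sum_(k < d.+1) (dehomogenize p)`_k *: 'X_[mon2 d k].
Proof.
move=> /dhomogP hp'; have hp m : m \in msupp p -> mdeg m = d := @hp' m.
rewrite [X in dehomogenize X]mpolyE raddf_sum /=.
under eq_bigr do rewrite coef_sum scaler_suml.
rewrite exchange_big [LHS]mpolyE /=; apply: eq_big_seq => m mp.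
have lt_m : (m 0%R < d.+1)%N.
  by rewrite ltnS -(hp m mp) mdegE (bigD1 0) //= leq_addr.
rewrite (bigD1 (Ordinal lt_m)) //= dehomogenizeZ dehomogenizeX coefZ coefXn eqxx.
rewrite mulr1 big1 ?addr0 => [|k ne_k]; first by rewrite -[in RHS](hp m mp) mon2_mdeg.
rewrite coefZ coefXn; case: eqP => [eq_k|_]; last by rewrite mulr0 scale0r.
by case/eqP: ne_k; apply/val_inj.
Qed.

Lemma dehomogenize_inj d p q : p \is d.-homog -> q \is d.-homog ->
  dehomogenize p = dehomogenize q -> p = q.
Proof. by move=> hp hq eq_pq; rewrite (homogenizeK hp) eq_pq -homogenizeK. Qed.

End Dehomogenize.

(** [p ^+ 3 - q ^+ 3] splits into three linear factors over the constants [j K], and [A] is a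
    domain. *)
Lemma eq_expr3 (K : closedFieldType) (A : idomainType) (j : {rmorphism K -> A}) (p q : A) :
  p ^+ 3 = q ^+ 3 -> exists2 zeta, zeta ^+ 3 = 1 & p = j zeta * q.
Proof.
(* [w] solves [w ^+ 2 = -1 - w], hence is a cube root of unity. *)
move=> eq_pq; have [w] := @GRing.solve_monicpoly K 2 (fun=> -1) isT.
rewrite big_ord_recl big_ord1 /= expr0 mulr1 mulN1r expr1 => w2.
have w3 : w ^+ 3 = 1 by rewrite exprS w2 mulrBr mulrN1 -expr2 w2; ring.
have jw2 : j w ^+ 2 = -1 - j w by rewrite -rmorphXn w2 rmorphB rmorphN1.
have /eqP : (p - q) * ((p - j w * q) * (p - j (w ^+ 2) * q)) = 0.
  rewrite rmorphXn.
  (* An identity with [j w] as an indeterminate; the correction is a multiple of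
     [j w ^+ 2 + j w + 1], which vanishes. *)
  have -> : (p - q) * ((p - j w * q) * (p - j w ^+ 2 * q)) =
    p ^+ 3 - q ^+ 3 + (j w ^+ 2 + j w + 1) * (p * q * (q - p) + (j w - 1) * q ^+ 2 * (p - q)) by ring.
  by rewrite eq_pq jw2; ring.
rewrite !mulf_eq0 !subr_eq0 => /or3P[] /eqP eq_p.
- by exists 1; rewrite ?expr1n // rmorph1 mul1r.
- by exists w.
- by exists (w ^+ 2); rewrite // -exprM mulnC exprM w3 expr1n.
Qed.

(** * Pairs of forms as points of a 22-dimensional affine space *)

Section BinaryForms.
Variable R : realType.
Local Notation C := R[i].

Definition mono_form (d : nat) (k : 'I_d.+1) : binary_form R d :=
  indhomog d 'X_[mon2 d k].

Lemma binary_formE d (p : binary_form R d) :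
  p = \sum_(k < d.+1) (dehomogenize (p : {mpoly C[2]}))`_k *: mono_form k.
Proof.
apply/val_inj; rewrite [LHS](homogenizeK (dhomog_is_dhomog p)) linear_sum /=.
apply: eq_bigr => k _; rewrite insubdK //.
rewrite -[_ \in _]/(_ \is d.-homog) dhomogX; apply/eqP; exact: mdeg_mon2 (leq_ord k).
Qed.

Local Notation V := (binary_form R 8 * binary_form R 12)%type.
Local Notation dh8 p := (dehomogenize ((p : binary_form R 8) : {mpoly C[2]})).
Local Notation dh12 p := (dehomogenize ((p : binary_form R 12) : {mpoly C[2]})).

Lemma dim_V : \dim {: V} = 22%N.
Proof. by rewrite dimvf. Qed.

(** The basis behind [affine_coord] is not explicit; all that matters is that coordinates are fixed
    linear combinations of the 9 + 13 coefficients. *)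
Lemma affine_coordE (f : binary_form R 8) (g : binary_form R 12) i :
  affine_coord ((f, g) : V) i =
    \sum_(k < 9) affine_coord ((mono_form k, 0) : V) i * (dh8 f)`_k +
    \sum_(k < 13) affine_coord ((0, mono_form k) : V) i * (dh12 g)`_k.
Proof.
have -> : ((f, g) : V) = \sum_(k < 9) (dh8 f)`_k *: ((mono_form k, 0) : V) +
                  \sum_(k < 13) (dh12 g)`_k *: ((0, mono_form k) : V).
  have pairP (u u' : V) : u.1 = u'.1 -> u.2 = u'.2 -> u = u'.
    by case: u u' => [u1 u2] [u1' u2'] /= -> ->.
  apply: pairP; rewrite raddfD !raddf_sum /=.
    rewrite [X in _ = _ + X]big1 => [|k _]; last by rewrite scaler0.
    by rewrite addr0 [LHS]binary_formE.
  rewrite [X in _ = X + _]big1 => [|k _]; last by rewrite scaler0.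
  by rewrite add0r [LHS]binary_formE.
rewrite /affine_coord linearD !linear_sum /=; congr (_ + _).
  by apply: eq_bigr => k _; rewrite linearZ mulrC.
by apply: eq_bigr => k _; rewrite linearZ mulrC.
Qed.

Lemma exists_affine_point (x : 'I_(\dim {: V}) -> C) :
  exists u : V, affine_coord u =1 x.
Proof.
exists (\sum_i x i *: (vbasis {: V})`_i) => i.
exact/coord_sum_free/basis_free/vbasisP.
Qed.

(** Here 22 coordinates depend on 9 + 9 + 3 = 21 parameters. The sizes [a.+1] and [b.+1] make both
    factors nonzero, which excludes [psi = g] and [psi = -g]. *)
Lemma bad_locus_dependent a b : exists2 P : {mpoly C[\dim {: V}]}, P != 0 &
  forall (f phi : binary_form R 8) (g psi : binary_form R 12),
    (phi : {mpoly C[2]}) ^+ 3 + (psi : {mpoly C[2]}) ^+ 2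
      = (f : {mpoly C[2]}) ^+ 3 + (g : {mpoly C[2]}) ^+ 2 ->
    size (dh12 g - dh12 psi) = a.+1 -> size (dh12 g + dh12 psi) = b.+1 ->
    P.@[affine_coord ((f, g) : V)] = 0.
Proof.
(* All bad quadruples form a single type of points, so one [P] serves them all. *)
pose T := {t : (binary_form R 8 * binary_form R 8) * (binary_form R 12 * binary_form R 12) |
  [/\ (t.1.2 : {mpoly C[2]}) ^+ 3 + (t.2.2 : {mpoly C[2]}) ^+ 2
      = (t.1.1 : {mpoly C[2]}) ^+ 3 + (t.2.1 : {mpoly C[2]}) ^+ 2,
    size (dh12 t.2.1 - dh12 t.2.2) = a.+1 & size (dh12 t.2.1 + dh12 t.2.2) = b.+1]}.
pose f (t : T) := dh8 (sval t).1.1; pose phi (t : T) := dh8 (sval t).1.2.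
pose v (t : T) := dh12 (sval t).2.1 - dh12 (sval t).2.2.
pose w (t : T) := dh12 (sval t).2.1 + dh12 (sval t).2.2.
have [|||||||P P_neq0 P0] := @factor_algebraically_dependent _ T 8 a b 13 _ f phi v w
  (fun i t => affine_coord (((sval t).1.1, (sval t).2.1) : V) i)
  (fun i k => affine_coord ((mono_form k, 0) : V) i)
  (* The sum of the two factors is twice [g], whence the division by 2. *)
  (fun i k => affine_coord ((0, mono_form k) : V) i / 2).
- by rewrite dim_V.
- by move=> t; apply/size_dehomogenize/dhomog_is_dhomog.
- by move=> t; apply/size_dehomogenize/dhomog_is_dhomog.
- by case=> t [].
- by case=> t [].
- move=> t; have [/(congr1 (@dehomogenize _)) eq_fg _ _] := svalP t; move: eq_fg.
  rewrite !rmorphD !rmorphXn /v /w /f /phi => eq_fg.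
  rewrite -subr_sqr; apply/eqP; rewrite subr_eq addrAC eq_sym subr_eq.
  by rewrite eq_fg addrC.
- move=> i t; rewrite affine_coordE; congr (_ + _); apply: eq_bigr => k _.
  rewrite -mulrA; congr (_ * _); rewrite /v /w addrACA addNr addr0 -mulr2n coefMn.
  by rewrite -[X in _ * X]mulr_natl mulKf // Num.Theory.pnatr_eq0.
exists P => // f' phi' g' psi' eq_fg sv sw.
exact: (P0 (exist _ ((f', phi'), (g', psi')) (And3 eq_fg sv sw))).
Qed.

End BinaryForms.

(** * The open set of uniqueness *)

Local Open Scope classical_set_scope.

Theorem theorem1p1 (R : realType) :
  exists W : set (binary_form R 8 * binary_form R 12)%type,
    [/\ zariski_open W,
        W !=set0
      & forall (f : binary_form R 8) (g : binary_form R 12), W (f, g) ->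
        forall (phi : binary_form R 8) (psi : binary_form R 12),
          (phi : {mpoly R[i][2]}) ^+ 3 + (psi : {mpoly R[i][2]}) ^+ 2
            = (f : {mpoly R[i][2]}) ^+ 3 + (g : {mpoly R[i][2]}) ^+ 2 ->
          exists zeta eps : R[i],
            [/\ zeta ^+ 3 = 1,
                eps = 1 \/ eps = -1,
                phi = zeta *: f
              & psi = eps *: g]].
Proof.
(* Dehomogenizing may lower the degrees of [g - psi] and [g + psi], so every pair of degrees from 0
   to 12 gets its polynomial. *)
have /fin_all_exists2[P P_neq0 P0] (ab : 'I_13 * 'I_13) :=
  bad_locus_dependent R ab.1 ab.2.
pose Q := \prod_ab P ab.
have Q_neq0 : Q != 0 by apply/prodf_neq0 => ab _; exact: P_neq0.
exists [set u | Q.@[affine_coord u] != 0]; split.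
- exists [set Q]; apply/seteqP; split=> [u /negP/negPn/eqP Qu _ -> //|u Qu /=].
  by rewrite (Qu Q erefl) eqxx.
- have [x Qx] := exists_meval_neq0 Q_neq0; have [u ux] := exists_affine_point x.
  by exists u; rewrite /= (meval_eq _ ux).
move=> f g /= Qfg phi psi eq_fg.
(* Once [psi] is [g] up to sign, the cubes of [phi] and [f] agree. *)
have cube_case (eps : R[i]) : eps = 1 \/ eps = -1 -> psi = eps *: g ->
    exists zeta eps : R[i], [/\ zeta ^+ 3 = 1, eps = 1 \/ eps = -1,
      phi = zeta *: f & psi = eps *: g].
  move=> eps1 psiE; have psi2 : (psi : {mpoly R[i][2]}) ^+ 2 = (g : {mpoly R[i][2]}) ^+ 2.
    rewrite psiE linearZ /= exprZn.
    by case: eps1 => ->; rewrite ?sqrrN expr1n scale1r.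
  have [zeta z3 phiE] := @eq_expr3 _ _ (@mpolyC 2 R[i]) phi f (addIr _ (etrans eq_fg
    (congr1 (fun p => _ + p) (esym psi2)))).
  exists zeta, eps; split=> //; apply/val_inj.
  by rewrite linearZ /= -mul_mpolyC.
have [v0|v_neq0] := eqVneq (dehomogenize (g : {mpoly R[i][2]}) - dehomogenize (psi : {mpoly R[i][2]})) 0.
  apply: (cube_case 1); first by left.
  rewrite scale1r; apply/val_inj/(dehomogenize_inj (d := 12)); try exact: dhomog_is_dhomog.
  by apply/esym/eqP; rewrite -subr_eq0 v0.
have [w0|w_neq0] := eqVneq (dehomogenize (g : {mpoly R[i][2]}) + dehomogenize (psi : {mpoly R[i][2]})) 0.
  apply: (cube_case (-1)); first by right.
  rewrite scaleN1r; apply/val_inj/(dehomogenize_inj (d := 12)); try exact: dhomog_is_dhomog.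
  by apply/eqP; rewrite linearN rmorphN -addr_eq0 addrC w0.
(* Both factors are now nonzero, so the pair is bad and the factor of [Q] for their degrees vanishes
   at it. *)
case/negP: Qfg; apply/eqP.
have size_lt (p : {poly R[i]}) : p != 0 -> (size p <= 13)%N ->
    exists k : 'I_13, size p = k.+1.
  rewrite -size_poly_gt0; case: (size p) => // k _ lt_k.
  by exists (Ordinal lt_k).
have sg := size_dehomogenize (dhomog_is_dhomog g).
have spsi := size_dehomogenize (dhomog_is_dhomog psi).
have [|a sv] := size_lt _ v_neq0.
  by rewrite (leq_trans (size_polyD _ _)) // size_polyN geq_max sg spsi.
have [|b sw] := size_lt _ w_neq0.
  by rewrite (leq_trans (size_polyD _ _)) // geq_max sg spsi.
rewrite rmorph_prod (bigD1 (a, b)) //=.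
by rewrite (P0 (a, b) f phi g psi) // mul0r.
Qed.
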